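(* Let $A\in\mathbb{C}^{m\times n}$, $0\neq W\in\mathbb{C}^{n\times m}$ and $q\in\mathbb{N}\cup\{0\}$. The unique matrix $X\in\mathbb{C}^{m\times n}$ satisfying the conditions $$AWX=AW(WAWP_{(AW)^q})^\dagger\quad\text{and}\quad\mathcal{R}(X)\subseteq\mathcal{R}(P_{(AW)^q}(WAW)^* )$$ is given by $X=A^{\diamond_q,W}$ (that is, $A^{\diamond_q,W}$ satisfies both conditions and is the only matrix that does).
   Context: $B^*$ is the conjugate transpose, $B^\dagger$ the Moore-Penrose inverse and $\mathcal{R}(B)$ the column space of $B$; $P_B:=BB^\dagger$ is the orthogonal projector onto $\mathcal{R}(B)$. By convention $(AW)^0=I_m$. The $W$-weighted $q$-BT inverse $A^{\diamond_q,W}$ is the unique $X\in\mathbb{C}^{m\times n}$ satisfying $XWAWX=X$, $XWA=(WAWP_{(AW)^q})^\dagger WA$, $AWX=AW(WAWP_{(AW)^q})^\dagger$; explicitly $A^{\diamond_q,W}=(WAWP_{(AW)^q})^\dagger$. *)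

(* Defs.v *)
From mathcomp Require Import all_boot all_order all_algebra.
From mathcomp Require Import complex.
From mathcomp Require Import reals.

Set Implicit Arguments.
Unset Strict Implicit.
Unset Printing Implicit Defensive.

Import Order.TTheory GRing.Theory Num.Theory.
Local Open Scope ring_scope.
Local Open Scope sesquilinear_scope.

Section ConjugateTranspose.
Variable C : numClosedFieldType.

Lemma adjmxM m n p (A : 'M[C]_(m, n)) (B : 'M[C]_(n, p)) :
  (A *m B)^t* = B^t* *m A^t*.
Proof. by rewrite trmx_mul map_mxM. Qed.

Lemma adjmx_inv n (A : 'M[C]_n) : (invmx A)^t* = invmx (A^t*).
Proof. by rewrite trmx_inv map_invmx. Qed.

Lemma mulmx_adj_eq0 m n (A : 'M[C]_(m, n)) : A *m A^t* = 0 -> A = 0.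
Proof.
move=> A0; apply/matrixP => i j; rewrite mxE.
have /eqP := congr1 (fun M : 'M[C]_m => M i i) A0; rewrite !mxE.
under eq_bigr => k _ do rewrite !mxE -normCK.
rewrite psumr_eq0 => [|k _]; last by rewrite exprn_ge0.
by move=> /allP/(_ j); rewrite mem_index_enum => /(_ isT) /=; rewrite sqrf_eq0 normr_eq0 => /eqP.
Qed.

Lemma row_free_adj_unit r n (G : 'M[C]_(r, n)) :
  row_free G -> G *m G^t* \in unitmx.
Proof.
move=> fG; rewrite -row_free_unit; apply/row_freeP.
exists (invmx (G *m G^t*)); apply: mulmxV; rewrite -row_free_unit -kermx_eq0.
set K := kermx _; have K0 : K *m (G *m G^t*) = 0 by apply: mulmx_ker.
have : K *m G = 0.
  by apply: mulmx_adj_eq0; rewrite adjmxM !mulmxA -[K *m G *m _]mulmxA K0 mul0mx.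
by move/eqP; rewrite mulmx_free_eq0.
Qed.

End ConjugateTranspose.

Section Inverses.
Variable C : numClosedFieldType.

Definition penrose m n (B : 'M[C]_(m, n)) (X : 'M[C]_(n, m)) : bool :=
  [&& B *m X *m B == B, X *m B *m X == X,
      (B *m X)^t* == B *m X & (X *m B)^t* == X *m B].

(* The full-rank factorization formula for the Moore-Penrose inverse. *)
Lemma penrose_factor m n r (F : 'M[C]_(m, r)) (G : 'M[C]_(r, n)) :
  F^t* *m F \in unitmx -> G *m G^t* \in unitmx ->
  penrose (F *m G)
    (G^t* *m invmx (G *m G^t*) *m (invmx (F^t* *m F) *m F^t*)).
Proof.
move=> uF uG; set X := G^t* *m _ *m _.
have BX : F *m G *m X = F *m (invmx (F^t* *m F) *m F^t*).
  by rewrite /X !mulmxA -(mulmxA F G) -[F *m _ *m _]mulmxA mulmxV// mulmx1.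
have XB : X *m (F *m G) = G^t* *m invmx (G *m G^t*) *m G.
  rewrite /X !mulmxA -[_ *m F^t* *m F]mulmxA.
  by rewrite -[_ *m _ *m (F^t* *m F)]mulmxA mulVmx// mulmx1.
have adjFF : (F^t* *m F)^t* = F^t* *m F by rewrite adjmxM trmxCK.
have adjGG : (G *m G^t*)^t* = G *m G^t* by rewrite adjmxM trmxCK.
apply/and4P; split; apply/eqP.
- rewrite BX !mulmxA -[_ *m F^t* *m F]mulmxA.
  by rewrite -[_ *m _ *m (F^t* *m F)]mulmxA mulVmx// mulmx1.
- rewrite XB /X !mulmxA -[_ *m G *m G^t*]mulmxA.
  by rewrite -[_ *m _ *m (G *m G^t*)]mulmxA mulVmx// mulmx1.
- by rewrite BX !adjmxM adjmx_inv adjFF trmxCK mulmxA.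
- by rewrite XB !adjmxM adjmx_inv adjGG trmxCK mulmxA.
Qed.

Lemma penrose_exists m n (B : 'M[C]_(m, n)) : exists X, penrose B X.
Proof.
have uG : row_base B *m (row_base B)^t* \in unitmx.
  by apply: row_free_adj_unit; apply: row_base_free.
have uF : (col_base B)^t* *m col_base B \in unitmx.
  rewrite -{2}[col_base B]trmxCK; apply: row_free_adj_unit.
  by rewrite row_free_map /row_free mxrank_tr; apply: col_base_full.
by move: (penrose_factor uF uG); rewrite mulmx_base => HX; eexists; exact: HX.
Qed.

Lemma penrose_unique m n (B : 'M[C]_(m, n)) X Y :
  penrose B X -> penrose B Y -> X = Y.
Proof.
move=> /and4P[/eqP X1 /eqP X2 /eqP X3 /eqP X4].
move=> /and4P[/eqP Y1 /eqP Y2 /eqP Y3 /eqP Y4].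
have BXY : B *m X = B *m Y.
  by rewrite -X3 -{1}Y1 -mulmxA adjmxM X3 Y3 mulmxA X1.
have XYB : X *m B = Y *m B.
  by rewrite -X4 -{1}Y1 -mulmxA mulmxA adjmxM X4 Y4 -mulmxA [B *m _]mulmxA X1.
by rewrite -X2 -mulmxA BXY mulmxA XYB Y2.
Qed.

Definition mpinv m n (B : 'M[C]_(m, n)) : 'M[C]_(n, m) :=
  xchoose (penrose_exists B).

Lemma mpinvP m n (B : 'M[C]_(m, n)) : penrose B (mpinv B).
Proof. exact: xchooseP. Qed.

Definition orthproj m n (B : 'M[C]_(m, n)) : 'M[C]_m := B *m mpinv B.

Definition colspace m n (B : 'M[C]_(m, n)) : {vspace 'cV[C]_m} :=
  limg (linfun (mulmx B : 'cV[C]_n -> 'cV[C]_m)).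

Lemma colspaceP m n (B : 'M[C]_(m, n)) (y : 'cV[C]_m) :
  reflect (exists x : 'cV[C]_n, y = B *m x) (y \in colspace B).
Proof.
apply: (iffP memv_imgP) => [[x _ ->]|[x ->]]; exists x; rewrite ?lfunE ?memvf//.
Qed.

Section WeightedBT.
Variables (m n : nat) (A : 'M[C]_(m, n)) (W : 'M[C]_(n, m)) (q : nat).

Definition wqbt_core : 'M[C]_(m, n) :=
  mpinv (W *m A *m W *m orthproj ((A *m W) ^+ q)).

Definition wqbt_axioms (X : 'M[C]_(m, n)) : bool :=
  [&& X *m W *m A *m W *m X == X,
      X *m W *m A == wqbt_core *m W *m A
    & A *m W *m X == A *m W *m wqbt_core].

Lemma wqbt_coreP : wqbt_axioms wqbt_core.
Proof.
rewrite /wqbt_axioms !eqxx !andbT.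
have /and4P[_ /eqP PP /eqP P3 _] := mpinvP ((A *m W) ^+ q).
rewrite /wqbt_core; set P := orthproj _; set B := W *m A *m W *m P.
have P2 : P *m P = P by rewrite /P /orthproj -mulmxA [mpinv _ *m _]mulmxA PP.
have /and4P[_ /eqP B2 _ /eqP B4] := mpinvP B.
have PB : P *m mpinv B = mpinv B.
  suff PBB : P *m (mpinv B *m B) = mpinv B *m B by rewrite -B2 mulmxA PBB.
  by rewrite -B4 adjmxM /B adjmxM mulmxA [P *m (_ *m _)]mulmxA P3 P2.
have BM : W *m A *m W *m mpinv B = B *m mpinv B by rewrite -{1}PB mulmxA.
by apply/eqP; rewrite -[RHS]B2 -[RHS]mulmxA -BM !mulmxA.
Qed.

Lemma wqbt_exists : exists X, wqbt_axioms X.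
Proof. by exists wqbt_core; exact: wqbt_coreP. Qed.

Lemma wqbt_unique X Y : wqbt_axioms X -> wqbt_axioms Y -> X = Y.
Proof.
suff H Z : wqbt_axioms Z -> Z = wqbt_core by move=> /H-> /H->.
move=> /and3P[/eqP Z1 /eqP Z2 /eqP Z3].
have /and3P[/eqP K1 _ _] := wqbt_coreP.
rewrite -[LHS]Z1 Z2 -[RHS]K1 -!(mulmxA (wqbt_core *m W)).
by rewrite Z3.
Qed.

(* The W-weighted q-BT inverse, as the unique solution of its three defining
   equations; wqbtinvE gives its closed form. *)
Definition wqbtinv : 'M[C]_(m, n) := xchoose wqbt_exists.

Lemma wqbtinvP : wqbt_axioms wqbtinv.
Proof. exact: xchooseP. Qed.

Lemma wqbtinvE : wqbtinv = wqbt_core.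
Proof. exact: wqbt_unique wqbtinvP wqbt_coreP. Qed.

End WeightedBT.
End Inverses.

(* Main.v *)
Require Import Defs.
From mathcomp Require Import all_boot all_order all_algebra.
From mathcomp Require Import complex.
From mathcomp Require Import reals.

Set Implicit Arguments.
Unset Strict Implicit.
Unset Printing Implicit Defensive.

Import Order.TTheory GRing.Theory Num.Theory.
Local Open Scope ring_scope.
Local Open Scope sesquilinear_scope.

(** Put [P := orthproj ((A *m W) ^+ q)] and [B := W *m A *m W *m P].  As [P]
    is an orthogonal projector, [P *m (W *m A *m W)^t*] is [B^t*], so the range
    condition says that every column of [X] lies in the range of [B^t*].  The
    inverse [wqbtinv A W q] is [mpinv B], which has this property because
    [mpinv B = (mpinv B *m B) *m mpinv B] and [mpinv B *m B] is Hermitian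
    ([mpinv_adj_factor]).

    For uniqueness, let [Z] be the difference of two solutions.  Its columns
    are still in the range of [B^t*], hence fixed by [P]; together with
    [A *m W *m Z = 0] this gives [B *m Z = W *m (A *m W *m P *m Z) = 0].  So
    the columns of [Z] lie both in the kernel of [B] and in the range of
    [B^t*], which are orthogonal complements, and [Z = 0]
    ([ker_range_adj_eq0]). *)

Section Ranges.
Variable C : numClosedFieldType.

Lemma orthproj_adj m n (B : 'M[C]_(m, n)) : (orthproj B)^t* = orthproj B.
Proof. by have /and4P[_ _ /eqP] := mpinvP B. Qed.

Lemma orthproj_mulmx m n (B : 'M[C]_(m, n)) : orthproj B *m B = B.
Proof. by have /and4P[/eqP] := mpinvP B. Qed.

Lemma orthproj_idem m n (B : 'M[C]_(m, n)) :
  orthproj B *m orthproj B = orthproj B.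
Proof. by rewrite {2}/orthproj mulmxA orthproj_mulmx. Qed.

(** The quotient [U] can be taken to be [mpinv D *m X], since [orthproj D]
    fixes each column of [X]. *)
Lemma colspace_subP m n p (X : 'M[C]_(m, n)) (D : 'M[C]_(m, p)) :
  reflect (exists U, X = D *m U) (colspace X <= colspace D)%VS.
Proof.
apply: (iffP subvP) => [sXD|[U ->] y /colspaceP[x ->]]; last first.
  by apply/colspaceP; exists (U *m x); rewrite mulmxA.
exists (mpinv D *m X); rewrite mulmxA -/(orthproj D).
apply/matrixP=> i j; have /colspaceP[x Xx] : col j X \in colspace D.
  by apply: sXD; apply/colspaceP; exists (delta_mx j 0); rewrite colE.
have /matrixP/(_ i 0) : col j (orthproj D *m X) = col j X.
  by rewrite colE -mulmxA -colE Xx mulmxA orthproj_mulmx.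
by rewrite !mxE.
Qed.

(** The Moore-Penrose inverse of [B] has the same range as [B^t*]; this is the
    inclusion that comes from [mpinv B *m B] being Hermitian. *)
Lemma mpinv_adj_factor m n (B : 'M[C]_(m, n)) :
  mpinv B = B^t* *m ((mpinv B)^t* *m mpinv B).
Proof.
have /and4P[_ /eqP B2 _ /eqP B4] := mpinvP B.
by rewrite mulmxA -adjmxM B4 B2.
Qed.

(** The kernel of [B] is orthogonal to the range of [B^t*]. *)
Lemma ker_range_adj_eq0 m n p (B : 'M[C]_(m, n)) (U : 'M[C]_(m, p)) :
  B *m (B^t* *m U) = 0 -> B^t* *m U = 0.
Proof.
move=> BZ0; suff Zt0 : (B^t* *m U)^t* = 0.
  by rewrite -[LHS]trmxCK Zt0 trmx0 map_mx0.
apply: mulmx_adj_eq0; rewrite trmxCK.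
by rewrite adjmxM trmxCK -mulmxA BZ0 mulmx0.
Qed.

End Ranges.

Theorem theorem3p2 (R : realType) (m n : nat)
    (A : 'M[R[i]]_(m, n)) (W : 'M[R[i]]_(n, m)) (q : nat) (hW : W != 0) :
  unique
    (fun X : 'M[R[i]]_(m, n) =>
       A *m W *m X
         = A *m W *m mpinv (W *m A *m W *m orthproj ((A *m W) ^+ q))
       /\ (colspace X
             <= colspace (orthproj ((A *m W) ^+ q) *m (W *m A *m W)^t*))%VS)
    (wqbtinv A W q).
Proof.
rewrite wqbtinvE /wqbt_core; set P := orthproj _.
set B := W *m A *m W *m P.
have -> : P *m (W *m A *m W)^t* = B^t* by rewrite [RHS]adjmxM orthproj_adj.
split=> [|Y [AWY /colspace_subP[U YU]]].
  by split=> //; apply/colspace_subP; eexists; apply: mpinv_adj_factor.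
have [V KV] : exists V, mpinv B = B^t* *m V.
  by eexists; apply: mpinv_adj_factor.
have YK : Y - mpinv B = B^t* *m (U - V) by rewrite mulmxBr -YU -KV.
have PBt : P *m B^t* = B^t*.
  by rewrite adjmxM orthproj_adj mulmxA orthproj_idem.
apply/esym/eqP; rewrite -subr_eq0 YK; apply/eqP/ker_range_adj_eq0.
have -> : B *m (B^t* *m (U - V)) = W *m (A *m W *m (B^t* *m (U - V))).
  by rewrite -[in RHS]PBt /B !mulmxA.
by rewrite -YK mulmxBr AWY subrr mulmx0.
Qed.
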